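(* Let $X$ be a continuum. For each $p\in X$, $HS(p,X)$ is unicoherent.
   Context: A continuum is a nondegenerate (more than one point) compact connected metric space. For a continuum $X$, $C(X)$ is the hyperspace of all subcontinua of $X$, i.e. all nonempty closed connected subsets of $X$ (singletons included), with the Hausdorff metric. For $p\in X$, $C(p,X)=\{A\in C(X):p\in A\}$, and $HS(p,X)=C(X)/C(p,X)$ is the quotient space obtained from $C(X)$ by shrinking $C(p,X)$ to a single point; it is a continuum. A continuum $Y$ is unicoherent provided that whenever $A$ and $B$ are closed, connected subsets of $Y$ with $Y=A\cup B$, the intersection $A\cap B$ is connected. *)

(* Defs.v *)
From HB Require Import structures.
From mathcomp Require Import all_boot all_order all_algebra.
From mathcomp Require Import generic_quotient.
From mathcomp Require Import all_classical all_reals all_analysis.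

Set Implicit Arguments.
Unset Strict Implicit.
Unset Printing Implicit Defensive.

Import Order.TTheory GRing.Theory Num.Theory.

Local Open Scope classical_set_scope.
Local Open Scope ring_scope.

HB.mixin Record Metric_isContinuum (R : numDomainType) X & Metric R X := {
  continuum_compact : compact [set: X] ;
  continuum_connected : connected [set: X] ;
  continuum_nondegenerate : exists x y : X, x <> y
}.

#[short(type="continuumType")]
HB.structure Definition Continuum (R : numDomainType) :=
  { X of Metric R X & Metric_isContinuum R X }.

Section hausdorff_distance.
Context {R : realType} {X : metricType R}.
Implicit Types (x y : X) (A B : set X).

(* [inf] and [sup] are real-valued with junk value 0 on empty or unbounded sets,
   so these two are meaningful only for nonempty sets in a bounded space, as is
   the case on the type [subcontinuum] below. *)
Definition point_set_dist x A : R := inf [set mdist x a | a in A].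

Definition hausdorff_dist A B : R :=
  Num.max (sup [set point_set_dist a B | a in A])
          (sup [set point_set_dist b A | b in B]).

Lemma point_set_dist_le x A a : A a -> point_set_dist x A <= mdist x a.
Proof.
move=> Aa; apply: ge_inf; last by exists a.
by exists 0 => _ [b _ <-]; exact: mdist_ge0.
Qed.

Lemma le_point_set_dist x A (r : R) : A !=set0 ->
  (forall a, A a -> r <= mdist x a) -> r <= point_set_dist x A.
Proof.
move=> [a Aa] rA; apply: lb_le_inf; first by exists (mdist x a), a.
by move=> _ [b Ab <-]; exact: rA.
Qed.

Lemma point_set_dist_ge0 x A : A !=set0 -> 0 <= point_set_dist x A.
Proof. by move=> A0; apply: le_point_set_dist => // a _; exact: mdist_ge0. Qed.

Lemma point_set_dist_triangle x y A : A !=set0 ->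
  point_set_dist x A <= mdist x y + point_set_dist y A.
Proof.
move=> A0; rewrite -lerBlDl; apply: le_point_set_dist => // a Aa.
by rewrite lerBlDl (le_trans (point_set_dist_le x Aa))// metric_triangle.
Qed.

Lemma point_set_dist_eq0 x A : closed A -> A !=set0 ->
  point_set_dist x A = 0 -> A x.
Proof.
move=> cA A0 xA; apply: cA => V; rewrite -nbhs_ballE => -[e /= e0 eV].
apply: contrapT => AV.
suff : e <= point_set_dist x A by rewrite xA leNgt e0.
apply: le_point_set_dist => // a Aa; rewrite leNgt; apply/negP => xae.
by apply: AV; exists a; split=> //; apply: eV; rewrite ballEmdist.
Qed.

End hausdorff_distance.

Lemma continuum_bounded (R : realType) (X : continuumType R) :
  exists M : R, forall x y : X, mdist x y <= M.
Proof.
have [x0 _] := @continuum_nondegenerate R X.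
have /compact_near_coveringP/(_ R +oo (fun r x => mdist x0 x <= r)) :=
  @continuum_compact R X.
have nearP x : [set: X] x ->
    \forall x' \near x & r \near +oo, (mdist x0 x' : R) <= r.
  move=> _.
  exists (ball x 1, [set r | mdist x0 x + 1 <= r]).
    split=> /=; first exact: nbhsx_ballx.
    by exists (mdist x0 x + 1); split; [exact: num_real|move=> r /ltW].
  case=> x' r [/=]; rewrite ballEmdist/= => xx' rP.
  apply: le_trans rP; apply: (le_trans (metric_triangle _ x _)).
  by rewrite lerD2l ltW.
move=> /(_ _ nearP) [r [_ rP]].
have Mx x : mdist x0 x <= r + 1 by apply: (rP (r + 1)) => //; rewrite ltrDl.
exists ((r + 1) + (r + 1)) => x y.
by rewrite (le_trans (metric_triangle _ x0 _))// lerD// metric_sym.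
Qed.

(* The hyperspace C(X); its metric is the Hausdorff metric. *)
Record subcontinuum (R : realType) (X : continuumType R) : Type := Subcontinuum {
  subcontinuum_set :> set X ;
  _ : [/\ subcontinuum_set !=set0,
          closed subcontinuum_set & connected subcontinuum_set]
}.

Section hyperspace.
Context {R : realType} {X : continuumType R}.
Local Notation CX := (subcontinuum X).
Implicit Types A B C : CX.

Lemma subcontinuum_neq0 A : (A : set X) !=set0. Proof. by case: A => ? []. Qed.

Lemma subcontinuum_closed A : closed (A : set X). Proof. by case: A => ? []. Qed.

Lemma subcontinuum_connected A : connected (A : set X).
Proof. by case: A => ? []. Qed.

Lemma subcontinuum_eq A B : (A : set X) = B -> A = B.
Proof.
case: A B => A hA [B hB] /= AB; move: hA hB; rewrite AB => hA hB.
by rewrite (Prop_irrelevance hA hB).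
Qed.

Lemma point_set_dist_bounded A :
  exists M : R, forall x, point_set_dist x A <= M.
Proof.
have [M MP] := continuum_bounded X; have [a Aa] := subcontinuum_neq0 A.
by exists M => x; exact: (le_trans (point_set_dist_le x Aa)).
Qed.

Lemma hausdorff_dist_sym A B : hausdorff_dist A B = hausdorff_dist B A.
Proof. by rewrite /hausdorff_dist maxC. Qed.

Lemma point_set_dist_hausdorff A B (a : X) :
  (A : set X) a -> point_set_dist a B <= hausdorff_dist A B.
Proof.
move=> Aa; rewrite /hausdorff_dist le_max; apply/orP; left.
apply: ub_le_sup; last by exists a.
by have [M MP] := point_set_dist_bounded B; exists M => _ [b _ <-].
Qed.

Lemma hausdorff_dist_le A B (r : R) :
  (forall a, (A : set X) a -> point_set_dist a B <= r) ->
  (forall b, (B : set X) b -> point_set_dist b A <= r) -> hausdorff_dist A B <= r.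
Proof.
move=> AB BA; rewrite /hausdorff_dist ge_max; apply/andP; split.
- apply: ge_sup => [|_ [a Aa <-]]; last exact: AB.
  by have [a Aa] := subcontinuum_neq0 A; exists (point_set_dist a B), a.
- apply: ge_sup => [|_ [b Bb <-]]; last exact: BA.
  by have [b Bb] := subcontinuum_neq0 B; exists (point_set_dist b A), b.
Qed.

Lemma hausdorff_dist_ge0 A B : 0 <= hausdorff_dist A B.
Proof.
have [a Aa] := subcontinuum_neq0 A.
apply: le_trans (point_set_dist_hausdorff B Aa).
exact/point_set_dist_ge0/subcontinuum_neq0.
Qed.

Lemma hausdorff_distxx A : hausdorff_dist A A = 0.
Proof.
apply/eqP; rewrite eq_le hausdorff_dist_ge0 andbT.
by apply: hausdorff_dist_le => a Aa; rewrite -(mdistxx a); exact: point_set_dist_le.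
Qed.

Lemma hausdorff_dist_positivity A B : hausdorff_dist A B = 0 -> A = B.
Proof.
have sub (C D : CX) : hausdorff_dist C D = 0 -> (C : set X) `<=` D.
  move=> CD c Cc; have D0 := subcontinuum_neq0 D.
  apply: point_set_dist_eq0 => //; first exact: subcontinuum_closed.
  by apply/eqP; rewrite eq_le point_set_dist_ge0// andbT -CD point_set_dist_hausdorff.
move=> AB; apply: subcontinuum_eq; apply/seteqP; split; first exact: sub.
by apply: sub; rewrite hausdorff_dist_sym.
Qed.

Lemma hausdorff_dist_triangle B A C :
  hausdorff_dist A C <= hausdorff_dist A B + hausdorff_dist B C.
Proof.
have half (D E F : CX) d : (D : set X) d ->
    point_set_dist d F <= hausdorff_dist D E + hausdorff_dist E F.
  move=> Dd; rewrite -lerBlDr.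
  apply: (le_trans _ (point_set_dist_hausdorff E Dd)).
  apply: le_point_set_dist; first exact: subcontinuum_neq0.
  move=> e Ee; rewrite lerBlDr.
  apply: (le_trans (point_set_dist_triangle _ e _)).
    exact: subcontinuum_neq0.
  by rewrite lerD2l point_set_dist_hausdorff.
apply: hausdorff_dist_le => [a Aa|c Cc]; first exact: half.
by rewrite addrC (hausdorff_dist_sym B) (hausdorff_dist_sym A); exact: half.
Qed.

HB.instance Definition _ := gen_eqMixin CX.
HB.instance Definition _ := gen_choiceMixin CX.
HB.instance Definition _ := @isMetric.Build R CX
  (fun A B => hausdorff_dist A B) hausdorff_distxx hausdorff_dist_positivity
  hausdorff_dist_sym hausdorff_dist_triangle.

(* C(p, X) *)
Definition subcontinua_through (p : X) : set CX := [set A | (A : set X) p].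

End hyperspace.

Section collapse.
Context {T : topologicalType} (D : set T).

(* The quotient T / D, where D is shrunk to a point. *)
Definition collapse_rel : rel T := fun x y => `[< x = y \/ D x /\ D y >].

Lemma collapse_rel_refl : reflexive collapse_rel.
Proof. by move=> x; apply/asboolP; left. Qed.

Lemma collapse_rel_sym : symmetric collapse_rel.
Proof.
by move=> x y; apply/asboolP/asboolP => -[->|[? ?]]; [left|right|left|right].
Qed.

Lemma collapse_rel_trans : transitive collapse_rel.
Proof.
move=> y x z /asboolP[->//|[Dx Dy]] /asboolP[<-|[_ Dz]]; apply/asboolP;
by right.
Qed.

Canonical collapse_equiv :=
  EquivRel collapse_rel collapse_rel_refl collapse_rel_sym collapse_rel_trans.

Definition collapse : topologicalType :=
  quotient_topology {eq_quot collapse_equiv}%qT.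

End collapse.

Definition HS (R : realType) (X : continuumType R) (p : X) : topologicalType :=
  collapse (subcontinua_through p).

(* The empty set counts as connected in [connected]; this only concerns A or B
   empty, since disjoint nonempty closed sets do not cover a connected Y. *)
Definition unicoherent (Y : topologicalType) : Prop :=
  forall A B : set Y, closed A -> connected A -> closed B -> connected B ->
    [set: Y] = A `|` B -> connected (A `&` B).

(* Main.v *)
(* The projection C(X) -> HS(p, X) is closed and its fibres are connected, since
   C(p, X) is connected; so preimages of closed connected sets are connected and
   it suffices that C(X) is unicoherent. If C(X) = A \cup B with A \cap B = P
   \sqcup Q, gluing two copies of A to two copies of B straight along P and
   crosswise along Q gives a nontrivial double covering of C(X), encoded by
   a Z/2-valued cocycle on pairs of nearby points. But such a covering is always
   trivial. By compactness, subsets of X that are e-chained for a small e are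
   close to subcontinua, so the covering extends to them, and every e-chained
   set S is canonically joined to X by its iterated e-neighbourhoods. Transport
   along these sequences is compatible with passing from S to a nearby T, because
   the i-th neighbourhoods of S and T stay close and both sequences end at X.
   The same sequences show that C(p, X) is connected. *)
Require Import Defs.
From mathcomp Require Import all_boot all_order all_algebra.
From mathcomp Require Import generic_quotient.
From mathcomp Require Import all_classical all_reals all_analysis.
From mathcomp Require Import lra.

Set Implicit Arguments.
Unset Strict Implicit.
Unset Printing Implicit Defensive.

Import Order.TTheory GRing.Theory Num.Theory.

Local Open Scope classical_set_scope.
Local Open Scope ring_scope.

(** * Ultrafilters: images and membership by contradiction *)

Section ultrafilters.

Lemma ultra_fmap (S T : Type) (f : S -> T) (F : set_system S) :
  UltraFilter F -> UltraFilter (f @ F).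
Proof.
move=> FU; split=> [|G PG sFG]; first exact: fmap_proper_filter.
apply/seteqP; split=> // A GA.
have [//|FnA] := in_ultra_setVsetC (f @^-1` A) FU.
have GnA : G (~` A) by apply: sFG.
have : G (A `&` ~` A) by exact: filterI.
by rewrite setICr => /filter_not_empty.
Qed.

Lemma ultra_contra (T : Type) (F : set_system T) (A : set T) :
  UltraFilter F -> (F (~` A) -> False) -> F A.
Proof. by move=> FU nA; have [//|/nA] := in_ultra_setVsetC A FU. Qed.

Lemma near_ex2 (T : Type) (F : set_system T) (A B : set T) :
  ProperFilter F -> F A -> F B -> exists x, A x /\ B x.
Proof. by move=> PF FA FB; exact: (filter_ex (F := F) (filterI FA FB)). Qed.

End ultrafilters.

(** * Neighbourhoods and chains in metric spaces *)

Section metric_sets.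
Context {R : realType} {M : metricType R}.
Implicit Types (x y z : M) (A B S T : set M) (e d r : R).

Definition thicken e S : set M := [set y | exists2 x, S x & mdist x y < e].

(** A Hausdorff bound for arbitrary sets: the chained sets and neighbourhoods compared below need be
    neither closed nor connected. *)
Definition hclose e S T := S `<=` thicken e T /\ T `<=` thicken e S.

(* Equivalently, any two points of [S] are joined by an [e]-chain in [S]. *)
Definition chained e S := forall T, T `&` S !=set0 ->
  (forall x y, T x -> S x -> S y -> mdist x y < e -> T y) -> S `<=` T.

Lemma thicken_sub e S : 0 < e -> S `<=` thicken e S.
Proof. by move=> e0 x Sx; exists x => //; rewrite mdistxx. Qed.

Lemma thickenS e S T : S `<=` T -> thicken e S `<=` thicken e T.
Proof. by move=> ST y [x /ST Tx xy]; exists x. Qed.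

Lemma hclose_sym e S T : hclose e S T -> hclose e T S.
Proof. by case. Qed.

Lemma hclose_trans e d S T U :
  hclose e S T -> hclose d T U -> hclose (e + d) S U.
Proof.
move=> [ST TS] [TU UT]; split=> x.
- move=> /ST[y /TU[z Uz zy] yx]; exists z => //.
  by have := metric_triangle z y x; lra.
- move=> /UT[y /TS[z Uz zy] yx]; exists z => //.
  by have := metric_triangle z y x; lra.
Qed.

Lemma hcloseW e d S T : e <= d -> hclose e S T -> hclose d S T.
Proof.
move=> ed [ST TS]; split=> x; first by move=> /ST[y Ty yx]; exists y => //; lra.
by move=> /TS[y Ty yx]; exists y => //; lra.
Qed.

Lemma hclose_thicken e S : 0 < e -> hclose e S (thicken e S).
Proof.
move=> e0; split; last by [].
by move=> x Sx; apply: thicken_sub => //; exact: thicken_sub.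
Qed.

Lemma chainedW e d S : e <= d -> chained e S -> chained d S.
Proof.
move=> ed Se T TS dT; apply: Se => // x y Tx Sx Sy xy.
by apply: (dT x) => //; lra.
Qed.

Lemma thicken_chained e S : 0 < e -> chained e S -> chained e (thicken e S).
Proof.
move=> e0 cS T [t [Tt [s Ss st]]] eT.
have Ts : T s.
  apply: (eT t) => //; [by exists s|exact: thicken_sub|by rewrite metric_sym].
have ST : S `<=` T.
  apply: cS; first by exists s.
  by move=> x y Tx Sx Sy xy; apply: (eT x) => //; exact: thicken_sub.
by move=> y [x Sx xy]; apply: (eT x) => //; [exact: ST|exact: thicken_sub|exists x].
Qed.

Lemma open_thicken e S : open (thicken e S).
Proof.
rewrite openE => y [x Sx xy]; rewrite /interior/= -nbhs_ballE.
exists (e - mdist x y) => /=; first by rewrite subr_gt0.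
move=> z; rewrite ballEmdist/= => yz; exists x => //.
by have := metric_triangle x y z; lra.
Qed.

(** The part of [S] in [T] is clopen in [S]: it is cut out both by its own open [e]-neighbourhood
    and by the complement of that of [S] minus [T]. *)
Lemma connected_chained e S : 0 < e -> connected S -> chained e S.
Proof.
move=> e0 cS T [t [Tt St]] eT.
suff <- : T `&` S = S by move=> x [].
apply: cS; first by exists t.
- exists (thicken e (T `&` S)); first exact: open_thicken.
  apply/seteqP; split=> [x [Tx Sx]|y [Sy [x [Tx Sx] xy]]].
    by split=> //; exact: thicken_sub.
  by split=> //; exact: (eT x).
- exists (~` thicken e (S `\` T)); first exact/open_closedC/open_thicken.
  apply/seteqP; split=> [x [Tx Sx]|y [Sy nSy]].
    split=> // -[y [Sy nTy] yx]; apply: nTy.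
    by apply: (eT x) => //; rewrite metric_sym.
  split=> //; apply: contrapT => nTy; apply: nSy.
  exact: thicken_sub.
Qed.

Lemma separated_closed A B : closed (A `|` B) -> separated A B ->
  closed A /\ closed B.
Proof.
have H (C D : set M) : closed (C `|` D) -> separated C D -> closed C.
  move=> cCD [CD _] x clx.
  have [//|Dx] : (C `|` D) x.
    by apply: cCD; apply: closure_subset clx; left.
  by exfalso; have : (closure C `&` D) x by []; rewrite CD.
by move=> cAB sAB; split; [exact: H sAB|apply: (H B A); rewrite 1?setUC// separatedC].
Qed.

Lemma closed_far A x : closed A -> ~ A x ->
  exists2 e, 0 < e & forall y, mdist x y < e -> ~ A y.
Proof.
move=> cA nAx.
have : open_nbhs x (~` A) by split => //; exact: closed_openC.
move=> /open_nbhs_nbhs; rewrite -nbhs_ballE => -[e /= e0 eA].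
by exists e => // y xy; apply: eA; rewrite ballEmdist.
Qed.

(** * Uniform bounds from compactness *)

(** The open cover is replaced by the hereditary property [P]. If radius [e] is good at [x], radii
    below [e / 2] are good within [e / 2] of [x]; compactness turns this local uniformity into a
    global one. *)
Lemma lebesgue_number (P : set (set M)) :
  compact [set: M] ->
  (forall S T, S `<=` T -> P T -> P S) ->
  (forall x, exists2 e, 0 < e & P [set y | mdist x y < e]) ->
  exists2 e, 0 < e & forall x, P [set y | mdist x y < e].
Proof.
move=> /compact_near_coveringP cM PS Px.
have := cM R 0^'+ (fun e x => P [set y | mdist x y < e]) _.
case.
  move=> x _; have [e e0 Pe] := Px x.
  exists (ball x (e / 2), [set d | d < e / 2]).
    split=> /=; first by apply: nbhsx_ballx; rewrite divr_gt0.
    by apply: nbhs_right_lt; rewrite divr_gt0.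
  move=> [y d] [/=]; rewrite ballEmdist/= => xy de.
  apply: PS Pe => z /= yz.
  by have := metric_triangle x y z; lra.
move=> e /= e0 eP; exists (e / 2); first by rewrite divr_gt0.
move=> x; apply: (eP (e / 2)) => //=; last by rewrite divr_gt0.
by rewrite sub0r normrN gtr0_norm ?divr_gt0//; lra.
Qed.

(** A ball small enough to miss [A] or [B] must miss [B] when its centre is in [A]. *)
Lemma disjoint_closed_far A B : compact [set: M] -> closed A -> closed B ->
  A `&` B = set0 ->
  exists2 e, 0 < e & forall x y, A x -> B y -> e <= mdist x y.
Proof.
move=> cM cA cB AB.
have [|x|e e0 eP] := @lebesgue_number
    [set S | A `&` S = set0 \/ B `&` S = set0] cM.
- move=> S T ST [?|?]; [left|right]; apply/seteqP; split=> // z [? /ST ?];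
  by [rewrite -(_ : A `&` T = set0)|rewrite -(_ : B `&` T = set0)].
- have [Ax|/(closed_far cA)[e e0 eA]] := pselect (A x).
    have /(closed_far cB)[e e0 eB] : ~ B x.
      by move=> Bx; have : (A `&` B) x by []; rewrite AB.
    by exists e => //; right; apply/seteqP; split=> // y [By /eB].
  by exists e => //; left; apply/seteqP; split=> // y [Ay /eA].
exists e => // x y Ax By; rewrite leNgt; apply/negP => xy.
have [] := eP x; move/seteqP => [] + _.
  by move=> /(_ x); apply; split=> //=; rewrite mdistxx.
by move=> /(_ y); apply.
Qed.

Lemma iter_thickenS e n S T : S `<=` T ->
  iter n (thicken e) S `<=` iter n (thicken e) T.
Proof. by move=> ST; elim: n => //= n; exact: thickenS. Qed.

Lemma iter_thicken_le e m n S : 0 < e -> (m <= n)%N ->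
  iter m (thicken e) S `<=` iter n (thicken e) S.
Proof.
move=> e0 /subnK <-; elim: (n - m)%N => //= k /subset_trans; apply.
exact: thicken_sub.
Qed.

Lemma iter_thicken1_sym e n x y :
  iter n (thicken e) [set x] y -> iter n (thicken e) [set y] x.
Proof.
elim: n x y => [x y /= ->//|n IH x y /= [z /IH zx zy]].
rewrite -iterS iterSr; apply: iter_thickenS zx => _ ->.
by exists y => //; rewrite metric_sym.
Qed.

Lemma chained_iter_cover e : 0 < e -> compact [set: M] -> chained e [set: M] ->
  exists n, forall S, S !=set0 -> iter n (thicken e) S = setT.
Proof.
move=> e0 /compact_near_coveringP cM ceM.
have [x0|M0] := pselect (inhabited M); last first.
  by exists 0%N => S [x]; exfalso; apply: M0.
have {x0} [x0] := x0.
pose W x := exists n, iter n (thicken e) [set x0] x.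
have WT x : W x.
  apply: (ceM W) => //; first by exists x0; split=> //; exists 0%N.
  by move=> y z [n ny] _ _ yz; exists n.+1; exists y.
have := cM nat \oo (fun n x => iter n (thicken e) [set x0] x) _.
case.
  move=> x _; have [n nx] := WT x.
  exists (ball x e, [set m | (n < m)%N]).
    by split=> /=; [exact: nbhsx_ballx|exists n.+1].
  move=> [y m] [/=]; rewrite ballEmdist/= => xy nm.
  by apply: (iter_thicken_le e0 nm); exists x.
(* Every point is [n] steps from [x0]; going from [x] back to [x0] and on to [y] takes [n + n]. *)
move=> n _ /(_ n (leqnn _)) nP; exists (n + n)%N => S [x Sx].
apply/seteqP; split=> // y _.
rewrite iterD; apply: (@iter_thickenS e n [set x0]); last exact: nP.
move=> _ ->; apply: (@iter_thickenS e n [set x]); first by move=> _ ->.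
by apply: iter_thicken1_sym; exact: nP.
Qed.

(* Such a [c] describes a double covering of [M], trivial when [c] is a
   coboundary. *)
Definition cocycle d (c : M -> M -> bool) := forall x y z,
  mdist x y < d -> mdist y z < d -> mdist x z < d -> c x y (+) c y z = c x z.

Definition coboundary (c : M -> M -> bool) := exists (h : M -> bool) e,
  0 < e /\ forall x y, mdist x y < e -> c x y = h x (+) h y.

(** * From trivial double coverings to unicoherence *)

Lemma connected_locally_constant e (T : Type) (h : M -> T) A : 0 < e -> connected A ->
  (forall x y, A x -> A y -> mdist x y < e -> h x = h y) ->
  forall x y, A x -> A y -> h x = h y.
Proof.
move=> e0 /(connected_chained e0) cA hA x y Ax Ay.
apply: (cA [set y | h x = h y]) => //; first by exists x.
by move=> u v /= -> Au Av uv; exact: hA.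
Qed.

Lemma cocycle_unicoherent : compact [set: M] ->
  (forall d c, 0 < d -> cocycle d c -> coboundary c) -> unicoherent M.
Proof.
move=> cM triv A B clA cA clB cB AB; apply: contrapT => /connectedPn[E [E0 EU sE]].
set P := E false in E0 EU sE; set Q := E true in E0 EU sE.
have [p Pp] : P !=set0 by exact: E0.
have [q Qq] : Q !=set0 by exact: E0.
have [clP clQ] : closed P /\ closed Q.
  by apply: separated_closed => //; rewrite -EU; exact: closedI.
have PQ0 : P `&` Q = set0 by exact: separated_disjoint.
have [r r0 rP] := disjoint_closed_far cM clP clQ PQ0.
have PAB x : P x -> A x /\ B x by move=> Px; have : (A `&` B) x by rewrite EU; left.
have QAB x : Q x -> A x /\ B x by move=> Qx; have : (A `&` B) x by rewrite EU; right.
pose V := thicken (r / 2) Q; have r20 : 0 < r / 2 by lra.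
have QV x : Q x -> V x by exact: thicken_sub.
have PV x : P x -> ~ V x.
  by move=> Px [y Qy yx]; have := rP _ _ Px Qy; rewrite metric_sym; lra.
(* On each of these four kinds of sets the [c] defined below satisfies the cocycle identity, because
   membership in [A] or membership in [V] is constant there. *)
pose good S := [\/ A `&` S = set0, B `&` S = set0, V `&` S = set0 | S `<=` V].
have [d d0 dgood] : exists2 d, 0 < d & forall x, good [set y | mdist x y < d].
  apply: lebesgue_number => // [S T ST|x].
    have ST0 (C : set M) : C `&` T = set0 -> C `&` S = set0.
      by move=> CT; apply/seteqP; split=> // z [Cz /ST Tz]; rewrite -CT.
    case=> [/ST0 ?|/ST0 ?|/ST0 ?|TV]; [exact: Or41|exact: Or42|exact: Or43|].
    by apply: Or44; exact: subset_trans TV.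
  have [Ax|/(closed_far clA)[e e0 eA]] := pselect (A x); last first.
    by exists e => //; apply: Or41; apply/seteqP; split=> // y [Ay /eA].
  have [Bx|/(closed_far clB)[e e0 eB]] := pselect (B x); last first.
    by exists e => //; apply: Or42; apply/seteqP; split=> // y [By /eB].
  (* At distance at least [r] from [Q], a ball of radius [r / 2] misses [V]; centred in [Q], it lies
     in [V]. *)
  exists (r / 2) => //.
  have : (A `&` B) x by [].
  rewrite EU => -[Px|Qx]; last by apply: Or44 => y /= xy; exists x.
  apply: Or43; apply/seteqP; split=> // y [[z Qz zy] /= xy].
  have := rP _ _ Px Qz; have := metric_triangle x y z.
  by rewrite (metric_sym y z); lra.
pose a x := `[< A x >].
(* The crosswise gluing along [Q]: a step counts when it changes membership in [A] and starts near
   [Q]. *)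
pose c x y := (a x (+) a y) && `[< V x >].
have ccoc : cocycle d c.
  move=> x y z xy yz xz; rewrite /c.
  have Ux : mdist x x < d by rewrite mdistxx.
  have [S0|S0|S0|SV] := dgood x.
  - have na u : mdist x u < d -> a u = false.
      by move=> xu; apply/asboolP => Au; rewrite -[False]/(set0 u) -S0.
    by rewrite !na.
  - have aa u : mdist x u < d -> a u = true.
      move=> xu; apply/asboolP.
      have : (A `|` B) u by rewrite -AB.
      by case=> // Bu; exfalso; rewrite -[False]/(set0 u) -S0.
    by rewrite !aa.
  - have nV u : mdist x u < d -> `[< V u >] = false.
      by move=> xu; apply/asboolP => Vu; rewrite -[False]/(set0 u) -S0.
    by rewrite !nV// !andbF.
  - have VV u : mdist x u < d -> `[< V u >] = true by move=> /SV ?; apply/asboolP.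
    by rewrite !VV// !andbT; case: (a x); case: (a y); case: (a z).
have [h [e [e0 he]]] := triv d c d0 ccoc.
have hA x y : A x -> A y -> h x = h y.
  apply: (connected_locally_constant e0) => // {}x {}y Ax Ay /he.
  by rewrite /c /a (asboolT Ax) (asboolT Ay)/=; case: (h x); case: (h y).
(* Leaving [A] from a point of [Q] flips [h]; adding the indicator of [Q] undoes the flip and makes
   [h'] locally constant on [B]. *)
pose h' x := h x (+) `[< Q x >].
have hB x y : B x -> B y -> h' x = h' y.
  (* Below [e] the trivialization [h] computes [c]; below [r] no step joins [P] to [Q]. *)
  apply: (@connected_locally_constant (Num.min e r)) => //.
    by rewrite lt_min e0.
  move=> {}x {}y Bx By; rewrite lt_min => /andP[xye xyr].
  have Qa u : ~ A u -> `[< Q u >] = false.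
    by move=> nAu; apply/asboolP => /QAB[].
  have VQ u : A u -> B u -> `[< V u >] = `[< Q u >].
    move=> Au Bu; have : (A `&` B) u by [].
    rewrite EU => -[Pu|Qu]; last by rewrite !asboolT//; exact: QV.
    rewrite !asboolF//; first by move=> Qu; rewrite -[False]/(set0 u) -PQ0.
    exact: PV.
  have [Ax|nAx] := pselect (A x); have [Ay|nAy] := pselect (A y).
  - rewrite /h' (hA x y)//; congr (_ (+) _).
    have : (A `&` B) x by [].
    have : (A `&` B) y by [].
    rewrite EU => -[Py|Qy] [Px|Qx].
    + rewrite (asboolF (P := Q x)) ?(asboolF (P := Q y))// => Q'.
        by rewrite -[False]/(set0 y) -PQ0.
      by rewrite -[False]/(set0 x) -PQ0.
    + by have := rP _ _ Py Qx; rewrite metric_sym; lra.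
    + by have := rP _ _ Px Qy; lra.
    + by rewrite !asboolT.
  - have := he _ _ xye; rewrite /c /a /h' (Qa y)// (asboolT Ax) (asboolF nAy)/=.
    by rewrite VQ// => ->; case: (h x); case: (h y).
  (* [c] tests [V] at its first argument, so the pair is swapped to put the point of [A] first. *)
  - have := he y x; rewrite metric_sym => /(_ xye).
    rewrite /c /a /h' (Qa x)// (asboolT Ay) (asboolF nAx)/= VQ// => ->.
    by case: (h x); case: (h y).
  - have := he _ _ xye; rewrite /c /a /h' !Qa// (asboolF nAx) (asboolF nAy)/=.
    by case: (h x); case: (h y).
(* Through [A], [h] agrees at [p] and [q]; through [B] it must differ, as only [q] lies in [Q]. *)
have [Ap Bp] := PAB _ Pp; have [Aq Bq] := QAB _ Qq.
have := hB p q Bp Bq; rewrite /h' (hA p q)// (asboolT Qq) asboolF.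
  by case: (h q).
by move=> Qp; rewrite -[False]/(set0 p) -PQ0.
Qed.

End metric_sets.

(** * Limits of chained sets in the hyperspace *)

Section hyperspace_limits.
Context {R : realType} {X : continuumType R}.
Local Notation CX := (subcontinuum X).
Implicit Types (x y p : X) (S T : set X) (K L : CX) (e d r : R).

Let ultra_cvg (F : set_system X) : UltraFilter F -> exists x, F --> x.
Proof.
move=> FU; have := @continuum_compact R X; rewrite compact_ultra => /(_ F FU).
by move=> /(_ filterT)[x [_ ?]]; exists x.
Qed.

Lemma mdist_hclose K L e : mdist K L < e -> hclose e K L.
Proof.
have H (C D : CX) : mdist C D < e -> (C : set X) `<=` thicken e D.
  move=> CD x Cx.
  have := le_lt_trans (point_set_dist_hausdorff D Cx) CD.
  move=> /inf_lt[]; first exact: (@image_nonempty _ _ _ _ (subcontinuum_neq0 D)).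
  by move=> _ [y Dy <-] xy; exists y => //; rewrite metric_sym.
by move=> KL; split; apply: H => //; rewrite metric_sym.
Qed.

Lemma hclose_mdist K L e : hclose e K L -> mdist K L <= e.
Proof.
move=> [KL LK]; apply: hausdorff_dist_le => x.
  move=> /KL[y Ly yx]; apply: (le_trans (point_set_dist_le x Ly)).
  by rewrite metric_sym ltW.
move=> /LK[y Ly yx]; apply: (le_trans (point_set_dist_le x Ly)).
by rewrite metric_sym ltW.
Qed.

(** [K] collects the points that the sets [S i] approach along [F]. Points chosen in [S i] or in [K]
    converge along the ultrafilter, which forces Hausdorff closeness; fine chains in [S i] then
    exclude a gap in [K]. *)
Lemma ultra_limit_subcontinuum (I : Type) (F : set_system I) (S : I -> set X) :
  UltraFilter F -> (\forall i \near F, S i !=set0) ->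
  (forall e, 0 < e -> \forall i \near F, chained e (S i)) ->
  exists K : CX, (forall p, \forall i \near F, S i p -> (K : set X) p) /\
    forall e, 0 < e -> \forall i \near F, hclose e (S i) K.
Proof.
move=> FU S0 Sch.
pose K := [set x | forall e, 0 < e -> \forall i \near F, thicken e (S i) x].
have clK : closed K.
  move=> x clx e e0; have e20 : 0 < e / 2 by lra.
  have [y [Ky]] := clx _ (nbhsx_ballx x _ e20); rewrite ballEmdist/= => xy.
  apply: filterS (Ky _ e20) => i [z Sz zy]; exists z => //.
  by have := metric_triangle z y x; rewrite (metric_sym y x); lra.
have lim (s : I -> X) : exists x, forall e, 0 < e -> \forall i \near F, mdist x (s i) < e.
  have [x sx] := ultra_cvg (ultra_fmap s FU).
  by exists x => e e0; have := sx _ (nbhsx_ballx x _ e0); rewrite ballEmdist.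
have limK (s : I -> X) x : (\forall i \near F, S i (s i)) ->
    (forall e, 0 < e -> \forall i \near F, mdist x (s i) < e) -> K x.
  move=> Ss sx e e0; apply: filterS2 Ss (sx e e0) => i Si xs.
  by exists (s i) => //; rewrite metric_sym.
have [x0 _] := @continuum_nondegenerate R X.
have SK e : 0 < e -> \forall i \near F, S i `<=` thicken e K.
  move=> e0; apply: (ultra_contra FU) => nSK.
  (* On an [F]-large set of indices this picks a point violating the inclusion; [x0] is the default
     elsewhere. *)
  pose s i := xget x0 (S i `\` thicken e K).
  have sP : \forall i \near F, (S i `\` thicken e K) (s i).
    apply: filterS nSK => i /existsNP[y /not_implyP[Sy nKy]].
    by apply: xgetPex; exists y.
  have [x sx] := lim s.
  have Kx : K x by apply: (limK s) => //; apply: filterS sP => i [].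
  have [i []] := near_ex2 _ sP (sx _ e0).
  by move=> [_ +] xs; apply; exists x.
have KS e : 0 < e -> \forall i \near F, K `<=` thicken e (S i).
  move=> e0; have e20 : 0 < e / 2 by lra.
  apply: (ultra_contra FU) => nKS.
  pose s i := xget x0 (K `\` thicken e (S i)).
  have sP : \forall i \near F, (K `\` thicken e (S i)) (s i).
    apply: filterS nKS => i /existsNP[y /not_implyP[Ky nSy]].
    by apply: xgetPex; exists y.
  (* The limit [x] of points of [K] is in [K], so [S i] comes within [e / 2] of [x], hence within
     [e] of [s i]. *)
  have [x sx] := lim s.
  have Kx : K x.
    apply: clK => V; rewrite -nbhs_ballE => -[d /= d0 dV].
    have [i [[Ks _] xs]] := near_ex2 _ sP (sx _ d0).
    by exists (s i); split=> //; apply: dV; rewrite ballEmdist.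
  have [i [[[_ nS] xs] [y Sy yx]]] :=
    near_ex2 _ (filterI sP (sx _ e20)) (Kx _ e20).
  apply: nS; exists y => //.
  by have := metric_triangle y x (s i); lra.
have SKc e : 0 < e -> \forall i \near F, hclose e (S i) K.
  by move=> e0; apply: filterS2 (SK e e0) (KS e e0).
have K0 : K !=set0.
  have [i [[y Sy] SiK]] := near_ex2 _ S0 (SK _ (@ltr01 R)).
  by have [x Kx _] := SiK _ Sy; exists x.
have cK : connected K.
  apply: contrapT => /connectedPn[E [E0 EU sE]].
  have [clE clE'] : closed (E false) /\ closed (E true).
    by apply: separated_closed => //; rewrite -EU.
  have [e e0 eE] := disjoint_closed_far (@continuum_compact R X) clE clE'
    (separated_disjoint sE).
  have e30 : 0 < e / 3 by lra.
  have [i [Ci [SiK KSi]]] := near_ex2 _ (Sch _ e30) (SKc _ e30).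
  have [u Eu] := E0 false; have [v Ev] := E0 true.
  have [s Ss su] : thicken (e / 3) (S i) u by apply: KSi; rewrite EU; left.
  have [t St tv] : thicken (e / 3) (S i) v by apply: KSi; rewrite EU; right.
  (* A chain in [S i] starting near [E false] stays near it: a step ending near [E true] would put
     the two pieces closer than three times [e / 3]. *)
  have [w Ew wt] : thicken (e / 3) (E false) t.
    apply: Ci St; first by exists s; split=> //; exists u => //; rewrite metric_sym.
    move=> x y [z Ez zx] Sx Sy xy.
    have [z' + z'y] := SiK _ Sy.
    rewrite EU => -[?|Ez']; first by exists z'.
    have := eE _ _ Ez Ez'; have := metric_triangle z x z'.
    by have := metric_triangle x y z'; rewrite (metric_sym y z'); lra.
  by have := eE _ _ Ew Ev; have := metric_triangle w t v; lra.
exists (Subcontinuum (And3 K0 clK cK)); split=> //= p.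
have [Kp|nKp] := pselect (K p); first by apply: filterE.
have [e e0 eK] := closed_far clK nKp.
apply: filterS (SK e e0) => i SiK /SiK[y Ky yp].
by exfalso; apply: (eK y) => //; rewrite metric_sym.
Qed.

(** The preceding lemma, applied to the identity family, gives every ultrafilter a limit. *)
Lemma subcontinuum_compact : compact [set: CX].
Proof.
rewrite compact_ultra => F FU _.
have [||K [_ FK]] := @ultra_limit_subcontinuum CX F (fun K => K) FU.
- by apply: filterE => K; exact: subcontinuum_neq0.
- move=> e e0; apply: filterE => K.
  by apply: connected_chained => //; exact: subcontinuum_connected.
exists K; split=> // V; rewrite -nbhs_ballE => -[e /= e0 eV].
have e20 : 0 < e / 2 by lra.
apply: filterS (FK _ e20) => L /hclose_mdist LK.
by apply: eV; rewrite ballEmdist/= metric_sym; lra.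
Qed.

(** Otherwise pick a counterexample [S e] for each positive [e]; its limit along an ultrafilter
    finer than [0^'+] is a subcontinuum close to some [S e]. The clause on [p] keeps approximations
    inside C(p, X). *)
Lemma chained_near_subcontinuum p d : 0 < d -> exists2 e, 0 < e &
  forall S, S !=set0 -> chained e S ->
    exists2 K : CX, (S p -> (K : set X) p) & hclose d S K.
Proof.
move=> d0; apply: contrapT => nP.
(* Stated for all [e], with the empty set as filler when [e] is not positive, so that choice
   applies. *)
have bad e : exists S, 0 < e -> [/\ S !=set0, chained e S &
    forall K : CX, (S p -> (K : set X) p) -> ~ hclose d S K].
  have [e0|] := pselect (0 < e); last by exists set0.
  apply: contrapT => /forallNP nS; apply: nP; exists e => // S S0 cS.
  apply: contrapT => nK; apply: (nS S) => _; split=> // K Kp SK.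
  by apply: nK; exists K.
have [S SP] := choice bad.
have [F [FU F0]] := @ultraFilterLemma R 0^'+ _.
have Fpos : \forall e \near F, 0 < e by apply: F0; exact: nbhs_right_gt.
have [||K [Kp FK]] := ultra_limit_subcontinuum (S := S) FU.
- by apply: filterS Fpos => e /SP[].
- move=> e e0.
  have Fe : \forall d \near F, d < e by apply: F0; exact: nbhs_right_lt.
  by apply: filterS2 Fpos Fe => r /SP[_ cS _] /ltW re; exact: chainedW re cS.
have [e [[e0 ep] SK]] := near_ex2 _ (filterI Fpos (Kp p)) (FK _ d0).
by have [_ _ /(_ K ep)] := SP _ e0.
Qed.

End hyperspace_limits.

(** * Triviality of double coverings of C(X) *)

Section hyperspace.
Context {R : realType} {X : continuumType R}.
Local Notation CX := (subcontinuum X).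
Implicit Types (x y p : X) (S T : set X) (K L : CX) (e d r : R).

Lemma continuum_chained e : 0 < e -> chained e [set: X].
Proof. by move=> e0; apply: connected_chained => //; exact: continuum_connected. Qed.

Lemma iter_thicken_chained e n S : 0 < e -> chained e S ->
  chained e (iter n (thicken e) S).
Proof. by move=> e0 cS; elim: n => //= n; exact: thicken_chained. Qed.

Lemma iter_thicken_neq0 e n S : 0 < e -> S !=set0 -> iter n (thicken e) S !=set0.
Proof.
by move=> e0 [x Sx]; exists x; apply: (@iter_thicken_le _ _ e 0%N n S).
Qed.

(** All thickenings have the same radius, so the extra one commutes past the iterates and the bound
    does not grow with [n]. *)
Lemma hclose_iter_thicken e n S T : hclose e S T ->
  hclose e (iter n (thicken e) S) (iter n (thicken e) T).
Proof.
by move=> [ST TS]; split; rewrite -iterS iterSr; exact: iter_thickenS.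
Qed.

Lemma cocyclexx d (c : CX -> CX -> bool) K : 0 < d -> cocycle d c -> c K K = false.
Proof. by move=> d0 /(_ K K K); rewrite mdistxx => /(_ d0 d0 d0); case: (c K K). Qed.

Lemma subcontinuum_cocycle d (c : CX -> CX -> bool) :
  0 < d -> cocycle d c -> coboundary c.
Proof.
move=> d0 cc; have d50 : 0 < d / 5 by lra.
have [p _] := @continuum_nondegenerate R X.
have [e' e'0 e'P] := chained_near_subcontinuum p d50.
(* Two replacements by [phi] and a gap of [e + e] cost at most four fifths of [d], so [c] still
   applies. *)
pose e := Num.min e' (d / 5); have e0 : 0 < e by rewrite lt_min e'0.
have ed : e <= d / 5 by rewrite ge_min lexx orbT.
pose good S := S !=set0 /\ chained e S.
have phiP S : exists K : CX, good S -> hclose (d / 5) S K.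
  have [[S0 cS]|nS] := pselect (good S).
    have [|K _ SK] := e'P S S0; last by exists K.
    by apply: chainedW cS; rewrite ge_min lexx.
  have [|K _ _] := e'P [set: X] _ (continuum_chained e'0); first by exists p.
  by exists K.
have {phiP}[phi phiP] := choice phiP.
have [n nP] := chained_iter_cover e0 (@continuum_compact R X) (continuum_chained e0).
have gC K : good K.
  split; first exact: subcontinuum_neq0.
  by apply: connected_chained => //; exact: subcontinuum_connected.
have gI i S : good S -> good (iter i (thicken e) S).
  move=> [S0 cS]; split; first exact: iter_thicken_neq0.
  exact: iter_thicken_chained.
have phid S T : good S -> good T -> hclose (e + e) S T -> mdist (phi S) (phi T) < d.
  move=> /phiP pS /phiP pT ST.
  have := hclose_mdist (hclose_trans (hclose_sym pS) (hclose_trans ST pT)).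
  lra.
pose cS S T := c (phi S) (phi T).
have cST S T U : good S -> good T -> good U -> hclose (e + e) S T ->
    hclose (e + e) T U -> hclose (e + e) S U -> cS S T (+) cS T U = cS S U.
  by move=> gS gT gU ST TU SU; apply: cc; exact: phid.
pose N i S := iter i (thicken e) S.
(* Transport along the first [m] neighbourhoods of [S]. *)
pose H m S := \big[addb/false]_(i < m) cS (N i S) (N i.+1 S).
have ladder m S T : good S -> good T -> hclose e S T ->
    cS S T = (H m S (+) H m T) (+) cS (N m S) (N m T).
  move=> gS gT ST; elim: m => [|m ->]; first by rewrite /H !big_ord0.
  have ee : e <= e + e by lra.
  have close_step U : hclose (e + e) (N m U) (N m.+1 U).
    by apply: (hcloseW ee); exact: hclose_thicken.
  have NST i : hclose e (N i S) (N i T) by exact: hclose_iter_thicken.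
  (* The diagonal cuts each square of the ladder into two triangles for the cocycle identity; its
     length is why [e + e] is allowed. *)
  have diag : hclose (e + e) (N m S) (N m.+1 T).
    by apply: hclose_trans (NST m) _; exact: hclose_thicken.
  have := cST _ _ _ (gI m _ gS) (gI m _ gT) (gI m.+1 _ gT)
    (hcloseW ee (NST m)) (close_step T) diag.
  have := cST _ _ _ (gI m _ gS) (gI m.+1 _ gS) (gI m.+1 _ gT)
    (close_step S) (hcloseW ee (NST m.+1)) diag.
  rewrite /H !big_ord_recr/= -/(N m S) -/(N m T) -/(N m.+1 S) -/(N m.+1 T).
  move=> <-.
  set a := \big[_/_]_(_ < _) _; set b := \big[_/_]_(_ < _) _.
  case: (cS (N m S) (N m T)); case: (cS (N m T) (N m.+1 T));
  case: (cS (N m S) (N m.+1 S)); case: (cS (N m.+1 S) (N m.+1 T)) => //= _;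
  by case: a; case: b.
have cH S T : good S -> good T -> hclose e S T -> cS S T = H n S (+) H n T.
  (* After [n] steps both sequences have reached X, so the last rung vanishes. *)
  move=> gS gT ST; rewrite (ladder n)// /N !nP; [|by case: gT|by case: gS].
  by rewrite /cS (cocyclexx _ d0 cc) addbF.
have phiK K : mdist K (phi K) <= d / 5.
  exact: (hclose_mdist (phiP _ (gC K))).
(* [cS] evaluates [c] at [phi K] instead of [K]; the second summand corrects for this. *)
exists (fun K => H n K (+) c K (phi K)), e; split=> // K L KL.
have KL' := mdist_hclose KL.
have Kp := phiK K; have Lp := phiK L.
have tri1 := metric_triangle K L (phi L).
have tri2 := metric_triangle (phi K) K L.
have tri3 := metric_triangle (phi K) L (phi L).
have pKK := metric_sym (phi K) K; have pLL := metric_sym (phi L) L.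
have c1 : c K (phi K) (+) c (phi K) L = c K L by apply: cc; lra.
have c2 : c (phi K) L (+) c L (phi L) = c (phi K) (phi L) by apply: cc; lra.
have := cH _ _ (gC K) (gC L) KL'; rewrite /cS -c1 -c2.
case: (c K (phi K)); case: (c (phi K) L); case: (c L (phi L)) => /=;
by case: (H n K); case: (H n L).
Qed.

Lemma subcontinuum_unicoherent : unicoherent CX.
Proof.
apply: cocycle_unicoherent; first exact: subcontinuum_compact.
exact: subcontinuum_cocycle.
Qed.

(** * Closedness and connectedness of C(p, X) *)

Lemma closed_subcontinua_through p : closed (@subcontinua_through R X p).
Proof.
move=> K clK; apply: contrapT => /(closed_far (subcontinuum_closed (A := K)))[e e0 eK].
have [L [Lp]] := clK _ (nbhsx_ballx K _ e0).
rewrite ballEmdist => /mdist_hclose[_ /(_ p Lp)[y Ky yp]].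
by apply: (eK y) => //; rewrite metric_sym.
Qed.

(** The approximations to the neighbourhoods of [K] stay in C(p, X) and move by at most three
    quarters of [d], too little to change piece. All these sequences end at [phi] of X, so all [K]
    lie in one piece. *)
Lemma subcontinua_through_connected p : connected (@subcontinua_through R X p).
Proof.
apply: contrapT => /connectedPn[E [E0 EU sE]].
have [clE clE'] : closed (E false) /\ closed (E true).
  by apply: separated_closed => //; rewrite -EU; exact: closed_subcontinua_through.
have [d d0 dE] := disjoint_closed_far subcontinuum_compact clE clE'
  (separated_disjoint sE).
have d40 : 0 < d / 4 by lra.
have [e' e'0 e'P] := chained_near_subcontinuum p d40.
pose e := Num.min e' (d / 4); have e0 : 0 < e by rewrite lt_min e'0.
have ed : e <= d / 4 by rewrite ge_min lexx orbT.
pose good S := S p /\ chained e S.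
have phiP S : exists K : CX, good S -> (K : set X) p /\ hclose (d / 4) S K.
  have [[Sp cS]|nS] := pselect (good S).
    have [||K Kp SK] := e'P S; [by exists p| |by exists K => _; split=> //; exact: Kp].
    by apply: chainedW cS; rewrite ge_min lexx.
  have [|K _ _] := e'P [set: X] _ (continuum_chained e'0); first by exists p.
  by exists K.
have {phiP}[phi phiP] := choice phiP.
have [n nP] := chained_iter_cover e0 (@continuum_compact R X) (continuum_chained e0).
have gC K : (K : set X) p -> good K.
  by move=> Kp; split=> //; apply: connected_chained => //; exact: subcontinuum_connected.
have gI i S : good S -> good (iter i (thicken e) S).
  move=> [Sp cS]; split; last exact: iter_thicken_chained.
  exact: (@iter_thicken_le _ _ e 0%N i S).
have EP b : E b `<=` subcontinua_through p.
  by rewrite EU; case: b => K; [right|left].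
have E_close K L : (K : set X) p -> (L : set X) p -> mdist K L < d ->
    E false K <-> E false L.
  move=> Kp Lp KL.
  have : (E false `|` E true) L by rewrite -EU.
  have : (E false `|` E true) K by rewrite -EU.
  case=> EK [] EL; split=> // E'.
  - by have := dE _ _ EK EL; rewrite leNgt KL.
  - by have := dE _ _ EL EK; rewrite leNgt metric_sym KL.
  - by have := dE _ _ E' EK; rewrite leNgt mdistxx d0.
  - by have := dE _ _ E' EL; rewrite leNgt mdistxx d0.
have E_iter K i : (K : set X) p ->
    E false K <-> E false (phi (iter i (thicken e) K)).
  move=> Kp; have gK := gC _ Kp; elim: i => [|i ->] /=.
    have [Kp' /hclose_mdist KK] := phiP _ gK.
    by apply: E_close => //; lra.
  have [p1 h1] := phiP _ (gI i _ gK); have [p2 h2] := phiP _ (gI i.+1 _ gK).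
  apply: E_close => //.
  have := hclose_mdist (hclose_trans (hclose_sym h1)
    (hclose_trans (hclose_thicken _ e0) h2)).
  lra.
have [K EK] := E0 false; have [L EL] := E0 true.
have Kp := EP _ _ EK; have Lp := EP _ _ EL.
have : E false L.
  apply/(E_iter _ n Lp); rewrite nP; last by exists p.
  by rewrite -(nP K); [exact/(E_iter _ n Kp)|exists p].
by move=> EL'; have := dE _ _ EL' EL; rewrite leNgt mdistxx d0.
Qed.

End hyperspace.

(** * Shrinking a connected set to a point *)

Section collapse.
Local Open Scope quotient_scope.
Context {T : topologicalType} (D : set T).
Local Notation Q := (collapse D).

Let q (x : T) : Q := \pi_Q x.

Lemma collapse_eq x y : q x = q y <-> x = y \/ D x /\ D y.
Proof.
split; first by move=> /eqmodP/asboolP.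
by move=> xy; apply/eqmodP/asboolP.
Qed.

Lemma closed_collapse (A : set Q) : closed (q @^-1` A) -> closed A.
Proof.
move=> cA; rewrite -(setCK A); apply: open_closedC.
by rewrite /open/= /quotient_open preimage_setC; exact: closed_openC.
Qed.

Lemma collapse_surj (y : Q) : exists x, q x = y.
Proof. by exists (repr y); rewrite /q reprK. Qed.

(** A nonempty clopen part [B] of the preimage is saturated, and so is its complement there; their
    images are then closed, so the image of [B] is clopen in [A] and equals [A]. *)
Lemma connected_collapse_preimage (A : set Q) : connected D ->
  closed A -> connected A -> connected (q @^-1` A).
Proof.
move=> cD clA cA B B0 [U oU BU] [V clV BV].
have qA x y : q x = q y -> A (q x) -> A (q y) by move=> ->.
have cqA : closed (q @^-1` A).
  by apply: closed_comp => // x _; exact: pi_continuous.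
have clB : closed B by rewrite BV; exact: closedI.
have BA : B `<=` q @^-1` A by rewrite BU => x [].
(* [D] is the only possibly nontrivial fibre; if [B] meets it, then [B] contains it, because [D] is
   connected. *)
have sat x y : q x = q y -> B x -> B y.
  move=> qxy Bx; have [<-//|[Dx Dy]] := (collapse_eq x y).1 qxy.
  have DA z : D z -> A (q z).
    move=> Dz; rewrite (_ : q z = q x); first exact: BA.
    by apply/collapse_eq; right.
  suff : D `&` B = D by move/seteqP => [_ /(_ _ Dy)[]].
  apply: cD; first by exists x.
  - exists U => //; rewrite BU; apply/seteqP; split=> z [Dz]; first by case.
    by move=> Uz; split=> //; split=> //; exact: DA.
  - exists V => //; rewrite BV; apply/seteqP; split=> z [Dz]; first by case.
    by move=> Vz; split=> //; split=> //; exact: DA.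
have preim C : (forall x y, q x = q y -> C x -> C y) -> q @^-1` (q @` C) = C.
  move=> satC; apply/seteqP; split=> [x [y Cy yx]|x Cx]; last by exists x.
  exact: satC yx Cy.
have qB : closed (q @` B) by apply: closed_collapse; rewrite preim.
have clAB : closed (q @^-1` A `\` B).
  rewrite (_ : _ `\` _ = q @^-1` A `&` ~` U).
    by apply: closedI => //; exact: open_closedC.
  rewrite BU; apply/seteqP; split=> x [Ax nB]; split=> //.
    by move=> Ux; apply: nB.
  by case.
have qAB : closed (q @` (q @^-1` A `\` B)).
  apply: closed_collapse; rewrite preim// => x y xy [Ax nBx].
  by split; [exact: qA Ax|move=> By; apply: nBx; exact: sat By].
have BeqA : q @` B = A.
  apply: cA; first by have [x Bx] := B0; exists (q x), x.
  - exists (~` (q @` (q @^-1` A `\` B))); first exact: closed_openC.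
    apply/seteqP; split=> [_ [x Bx <-]|y [Ay nBy]].
      by split; [exact: BA|move=> [z [_ nBz] /esym xz]; apply: nBz; exact: sat Bx].
    have [x xy] := collapse_surj y; exists x => //; apply: contrapT => nBx.
    by apply: nBy; exists x => //; split=> //=; rewrite xy.
  - exists (q @` B) => //; apply/esym/setIidPr => _ [x Bx <-]; exact: BA.
by rewrite -BeqA preim.
Qed.

Lemma collapse_unicoherent : connected D -> unicoherent T -> unicoherent Q.
Proof.
move=> cD uT A B clA cA clB cB AB.
have cq C : closed C -> closed (q @^-1` C).
  by move=> clC; apply: closed_comp => // x _; exact: pi_continuous.
have qAB : q @` (q @^-1` A `&` q @^-1` B) = A `&` B.
  apply/seteqP; split=> [_ [x [Ax Bx] <-]//|y [Ay By]].
  by have [x xy] := collapse_surj y; exists x => //; split=> /=; rewrite xy.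
rewrite -qAB; apply: connected_continuous_connected; last first.
  exact/continuous_subspaceT/pi_continuous.
apply: uT; try exact: cq; try exact: connected_collapse_preimage.
by rewrite -preimage_setU -AB preimage_setT.
Qed.

End collapse.

Theorem theorem6p1 (R : realType) (X : continuumType R) (p : X) :
  unicoherent (HS p).
Proof.
apply: collapse_unicoherent; first exact: subcontinua_through_connected.
exact: subcontinuum_unicoherent.
Qed.
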